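(* Let $\Gamma^1$ and $\Gamma^2$ be isolated transitive hyperbolic sets of a partially hyperbolic symbolic skew-product $\Phi\in\mathcal{PHS}(M)$. Assume that $\Gamma^1$ is a $cs$-blender with a superposition domain $\mathcal{B}=\mathsf{V}\times B$ and that there is a point $P\in W^s_{loc}(\Gamma^2)$ such that $$W^{ss}_{loc}(\Phi^{-n}(P))\cap(\mathsf{V}\times M)\subset\mathcal{B}\quad\text{for some integer } n\ge 0 .$$ Then the unstable set of $\Gamma^1$ and the stable set of $\Gamma^2$ meet $\mathcal{S}$-robustly; that is, for any small enough $\mathcal{S}$-perturbation $\Psi\in\mathcal{PHS}(M)$ of $\Phi$ it holds that $W^u(\Gamma^1_\Psi)\cap W^s(\Gamma^2_\Psi)\ne\emptyset$.
   Context: SYMBOLIC SKEW-PRODUCTS. Let $\mathcal A$ be a finite alphabet with at least two symbols, $0<\nu<1$, $0<\alpha\le1$. $\Sigma=\mathcal A^{\mathbb Z}$ has the metric $d_\Sigma(\xi,\zeta)=\nu^\ell$, $\ell=\min\{i\ge0:\xi_i\ne\zeta_i\text{ or }\xi_{-i}\ne\zeta_{-i}\}$; $\tau$ is the shift $(\tau\xi)_i=\xi_{i+1}$. $M$ is a topological manifold (not necessarily compact) with distance $d$; $\mathcal M=\Sigma\times M$. A symbolic skew-product is a homeomorphism $\Phi=\tau\ltimes\phi_\xi$ of $\mathcal M$, $\Phi(\xi,x)=(\tau(\xi),\phi_\xi(x))$, with $\phi_\xi$ homeomorphisms of $M$. $\mathcal S(M)$ is the set of those for which there are $\gamma,\hat\gamma>0$,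 $C_0\ge0$ with $\gamma\,d(x,y)<d(\phi_\xi(x),\phi_\xi(y))<\hat\gamma^{-1}d(x,y)$ for all $x\ne y$ and $\xi$, and $d_{C^0}(\phi_\xi^{\pm1},\phi_\zeta^{\pm1})\le C_0\,d_\Sigma(\xi,\zeta)^\alpha$ whenever $\xi_0=\zeta_0$ ($C_0(\Phi)$ denotes the smallest such constant). Here $d_{C^0}(\phi,\psi)=\sum_{n\ge1}2^{-n}\frac{d_{C^0}(\phi,\psi)_{K_n}}{1+d_{C^0}(\phi,\psi)_{K_n}}$, $d_{C^0}(\phi,\psi)_K=\max_{x\in K}d(\phi(x),\psi(x))$, with $(K_n)$ relatively compact sets whose union is $M$. The metric on $\mathcal S(M)$ is $d_{\mathcal S}(\Phi,\Psi)=\max_\xi d_{C^0}(\phi_\xi^{\pm1},\psi_\xi^{\pm1})+\max_\xi|\mathrm{Lip}(\phi_\xi^{\pm1})-\mathrm{Lip}(\psi_\xi^{\pm1})|+|C_0(\Phi)-C_0(\Psi)|$; an $\mathcal S$-perturbation of $\Phi$ is a $\Psi$ that is $d_{\mathcal S}$-close to $\Phi$. $\mathcal{PHS}(M)\subset\mathcal S(M)$ consists of the partially hyperbolic ones: $\nu^\alpha<\gamma<1<\hat\gamma^{-1}<\nu^{-\alpha}$. STABLE SETS, HYPERBOLIC SETS. $W^s_{loc}(\xi)=\{\zeta:\zeta_i=\xi_i,\ i\ge0\}$, $W^u_{loc}(\xi)=\{\zeta:\zeta_i=\xi_i,\ i<0\}$. For compact $\Phi$-invariant $\Gamma$, $W^s(\Gamma)=\{P:\lim_{n\to\infty}d(\Phi^n(P),\Gamma)=0\}$,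 and $W^u(\Gamma)$ is the same for $\Phi^{-1}$. $\Gamma$ is isolated if it has a compact neighborhood $\mathcal U$ (isolating neighborhood) such that every invariant subset of $\mathcal U$ lies in $\Gamma$; then $W^s_{loc}(\Gamma)=\{P:\Phi^n(P)\in\mathcal U,\ n\ge0\}$, $W^u_{loc}(\Gamma)=\{P:\Phi^{-n}(P)\in\mathcal U,\ n\ge0\}$, and the continuation $\Gamma_\Psi$ is the maximal $\Psi$-invariant set in $\mathcal U$. With $W^s_\varepsilon(P)=\{Q:d(\Phi^n(Q),\Phi^n(P))\le\varepsilon,\ n\ge0\}$ and $W^u_\varepsilon(P)$ defined likewise with $\Phi^{-1}$, $\Gamma$ is hyperbolic if there are $\varepsilon,K>0$, $0<\theta<1$ with $d(\Phi^n(P),\Phi^n(Q))\le K\theta^n$ for $P\in\Gamma$, $Q\in W^s_\varepsilon(P)$, $n\ge0$, and $d(\Phi^{-n}(P),\Phi^{-n}(Q))\le K\theta^n$ for $P\in\Gamma$, $Q\in W^u_\varepsilon(P)$, $n\ge0$, and there is $\delta>0$ with $\#\,W^s_\varepsilon(P)\cap W^u_\varepsilon(Q)=1$ for $P,Q\in\Gamma$, $d(P,Q)\le\delta$. For isolated transitive hyperbolic $\Gamma$, $\mathrm{ind}^{cs}(\Gamma)$ (resp. $\mathrm{ind}^{cu}(\Gamma)$) is the topological dimension of $W^s_\varepsilon(P)\cap(\{\xi\}\times M)$ (resp. $W^u_\varepsilon(P)\cap(\{\xi\}\times M)$), $P=(\xi,x)\in\Gamma$ (standing assumption: these dimensions depend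 continuously on $P$, hence are constant). STRONG STABLE SETS. For $\Phi\in\mathcal{PHS}(M)$ there is a unique partition of $\mathcal M$ into local strong stable sets $W^{ss}_{loc}(\xi,x)\ni(\xi,x)$, each the graph of an $\alpha$-Hölder function $W^s_{loc}(\xi)\to M$ with constant at most $C_0(1-\gamma^{-1}\nu^\alpha)^{-1}$, varying continuously with $(\xi,x)$ and with $\Phi$, with $\Phi(W^{ss}_{loc}(P))\subset W^{ss}_{loc}(\Phi(P))$ and $W^{ss}_{loc}(P)\subset\{Q:d(\Phi^n(Q),\Phi^n(P))\to0\}$; likewise local strong unstable sets $W^{uu}_{loc}(\xi,x)$ over $W^u_{loc}(\xi)$. BLENDERS. A basic open set is $\mathcal B=\mathsf V\times B$ with $\mathsf V\subset\Sigma$, $B\subset M$ open. An $s$-disc in $\mathcal B$ is the graph of an $\alpha$-Hölder function $W^s_{loc}(\xi)\cap\mathsf V\to B$, $\xi\in\mathsf V$; two $s$-discs over the same $W^s_{loc}(\xi)$ are close if the functions are close as $\alpha$-Hölder functions. A collection $\mathfrak D^s$ of $s$-discs is open if every $s$-disc close enough to a member is contained in $\mathcal B$ and belongs to $\mathfrak D^s$. A transitive hyperbolic maximal invariant set $\Gamma$ in a relatively compact open set $\mathcal U$ is a $cs$-blender if $\mathrm{ind}^{cs}(\Gamma)>0$ and there are a basic open set $\mathcal B\subset\mathcal U$ (superposition domain) and an open set $\mathfrak D^s$ of $s$-discs in $\mathcal B$ (superposition region) such that for every small enough $\mathcal S$-perturbation $\Psi$ of $\Phi$, $W^u_{loc}(\Gamma_\Psi)\cap\mathcal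 D^s\ne\emptyset$ for all $\mathcal D^s\in\mathfrak D^s$. Standing assumption on $cs$-blenders of $\Phi\in\mathcal{PHS}(M)$: there is an $\mathcal S$-neighborhood of $\Phi$ such that for every $\Psi$ in it: (B1) if $W^{ss}_{loc}(P;\Psi)\cap(\mathsf V\times M)\subset\mathcal B$ then $W^{ss}_{loc}(P;\Psi)\cap(\mathsf V\times M)\in\mathfrak D^s$; (B2) if $W^{ss}_{loc}(P;\Phi)\cap(\mathsf V\times M)\subset\mathcal B$ then $W^u_{loc}(\Gamma_\Psi;\Psi)\cap W^{ss}_{loc}(P';\Psi)\ne\emptyset$ for all $P'$ close enough to $P$; (B3) for $\Lambda^u(\mathcal B;\Psi)=\bigcap_{n\ge0}\Psi^n(\mathcal B)$ and any $P\in\Lambda^u(\mathcal B;\Phi)$ there is $P_\Psi$ close to $P$ with $W^{uu}_{loc}(P_\Psi;\Psi)\cap\mathcal B\subset\Lambda^u(\mathcal B;\Psi)\subset W^u_{loc}(\Gamma_\Psi;\Psi)$.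
   Formalization: Adds the hypothesis that each point of W^s_loc(Γ²) is approximated by points of W^s(Γ²_Ψ) as Ψ→Φ; without it the claim fails, e.g. for a semistable fibre fixed point removed by a small rotation. Leaf inclusion in B is read with a non-empty trace, and ''close enough'' in (B2) uniformly in Ψ. *)

(* Defs.v *)
From HB Require Import structures.
From mathcomp Require Import all_boot all_order all_algebra.
From mathcomp Require Import all_classical all_reals all_analysis.

Set Implicit Arguments.
Unset Strict Implicit.
Unset Printing Implicit Defensive.

Import Order.TTheory GRing.Theory Num.Theory.
Import numFieldNormedType.Exports.

Local Open Scope classical_set_scope.
Local Open Scope ring_scope.

(* The scale nu is part of the type, so that the metric of the shift space can
   be a canonical instance. *)
Definition shift_space (R : realType) (A : finType)
  (nu : {itv R & `]0%Z, 1%Z[}) : Type := int -> A.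

Section ShiftMetric.
Context {R : realType} {A : finType} {nu : {itv R & `]0%Z, 1%Z[}}.
Local Notation Sigma := (shift_space A nu).

Definition differ_at (xi zeta : Sigma) (i : nat) : bool :=
  (xi (Posz i) != zeta (Posz i)) || (xi (- Posz i) != zeta (- Posz i)).

Definition shift_dist (xi zeta : Sigma) : R :=
  match pselect (exists i, differ_at xi zeta i) with
  | left diff => nu%:num ^+ ex_minn diff
  | right _ => 0
  end.

Lemma differ_atC xi zeta : differ_at xi zeta =1 differ_at zeta xi.
Proof. by move=> i; rewrite /differ_at !(eq_sym (xi _)). Qed.

Lemma shift_dist_ge0 xi zeta : 0 <= shift_dist xi zeta.
Proof. by rewrite /shift_dist; case: pselect. Qed.

Lemma shift_dist_ge xi zeta i :
  differ_at xi zeta i -> nu%:num ^+ i <= shift_dist xi zeta.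
Proof.
move=> di; rewrite /shift_dist; case: pselect => [h|]; last by case; exists i.
by case: ex_minnP => m _ /(_ _ di) mi; apply: ler_wiXn2l.
Qed.

Lemma shift_dist_le xi zeta e : 0 <= e ->
  (forall i, differ_at xi zeta i -> nu%:num ^+ i <= e) ->
  shift_dist xi zeta <= e.
Proof.
move=> e0 H; rewrite /shift_dist; case: pselect => // h.
by case: ex_minnP => m /H.
Qed.

Lemma shift_distxx xi : shift_dist xi xi = 0.
Proof.
apply/eqP; rewrite eq_le shift_dist_ge0 andbT.
by apply: shift_dist_le => // i; rewrite /differ_at !eqxx.
Qed.

Lemma shift_dist_positivity xi zeta : shift_dist xi zeta = 0 -> xi = zeta.
Proof.
move=> d0; apply/funext => j.
have H i : differ_at xi zeta i = false.
  by apply/negP => /shift_dist_ge; rewrite d0 leNgt exprn_gt0.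
have := H `|j|%N; rewrite /differ_at => /norP[/negPn/eqP pj /negPn/eqP nj].
by case: j pj nj => n // _; rewrite NegzE.
Qed.

Lemma shift_distC xi zeta : shift_dist xi zeta = shift_dist zeta xi.
Proof.
wlog suff H : xi zeta / shift_dist xi zeta <= shift_dist zeta xi.
  by apply/eqP; rewrite eq_le !H.
apply: shift_dist_le => [|i]; first exact: shift_dist_ge0.
by rewrite differ_atC; apply: shift_dist_ge.
Qed.

Lemma shift_dist_triangle zeta xi eta :
  shift_dist xi eta <= shift_dist xi zeta + shift_dist zeta eta.
Proof.
apply: shift_dist_le => [|i di]; first by rewrite addr_ge0// shift_dist_ge0.
have [d1|d1] := boolP (differ_at xi zeta i).
  by rewrite (le_trans (shift_dist_ge d1))// lerDl shift_dist_ge0.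
have [d2|d2] := boolP (differ_at zeta eta i).
  by rewrite (le_trans (shift_dist_ge d2))// lerDr shift_dist_ge0.
case/norP: d1 => /negPn/eqP e1 /negPn/eqP e2.
by move: di d2; rewrite /differ_at e1 e2 => ->.
Qed.

HB.instance Definition _ := gen_eqMixin Sigma.
HB.instance Definition _ := gen_choiceMixin Sigma.
HB.instance Definition _ := isMetric.Build R Sigma
  shift_distxx shift_dist_positivity shift_distC shift_dist_triangle.

Definition shift (xi : Sigma) : Sigma := fun i => xi (i + 1).
Definition shiftV (xi : Sigma) : Sigma := fun i => xi (i - 1).

Definition Ws_loc (xi : Sigma) : set Sigma :=
  [set zeta | forall i : int, 0 <= i -> zeta i = xi i].
Definition Wu_loc (xi : Sigma) : set Sigma :=
  [set zeta | forall i : int, i < 0 -> zeta i = xi i].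

End ShiftMetric.

(* Separation comes with the metric. *)
Definition topological_manifold (R : realType) (M : metricType R) : Prop :=
  @second_countable M /\
  exists m : nat, forall x : M,
    exists (U : set M) (f : M -> 'rV[R]_m) (g : 'rV[R]_m -> M),
      [/\ open U /\ U x, open (f @` U), {in U, cancel f g},
          {within U, continuous f} & {within f @` U, continuous g}].

(* Lebesgue covering dimension of the subspace X of T. *)
Definition covering_dim_le (T : topologicalType) (X : set T) (n : nat) : Prop :=
  forall (k : nat) (U : 'I_k -> set T),
    (forall i, open (U i)) -> X `<=` \bigcup_i U i ->
  exists (l : nat) (V : 'I_l -> set T),
    [/\ forall j, open (V j), X `<=` \bigcup_j V j,
        forall j, exists i, X `&` V j `<=` U i
      & forall (x : T) (J : {set 'I_l}),
          X x -> (forall j, j \in J -> V j x) -> (#|J| <= n.+1)%N].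

Definition covering_dim (T : topologicalType) (X : set T) (n : nat) : Prop :=
  covering_dim_le X n /\ forall m, (m < n)%N -> ~ covering_dim_le X m.

Section SkewProducts.
Context {R : realType} {A : finType} {nu : {itv R & `]0%Z, 1%Z[}}
        {M : metricType R}.
Local Notation Sigma := (shift_space A nu).
Local Notation space := (Sigma * M)%type.

(* The maximum distance is the one underlying the library's product
   (pseudo-)metric structure. *)
Definition pdist (P Q : space) : R :=
  Num.max (mdist P.1 Q.1) (mdist P.2 Q.2).

(* Infinite when X is empty. *)
Definition dist_to (P : space) (X : set space) : \bar R :=
  ereal_inf [set (pdist P Q)%:E | Q in X].

Record skew_product := SkewProduct {
  fiber : Sigma -> M -> M ;
  fiberV : Sigma -> M -> M ;
  fiberK : forall xi, cancel (fiber xi) (fiberV xi) ;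
  fiberVK : forall xi, cancel (fiberV xi) (fiber xi) ;
  skew_continuous : continuous
    (fun P : space => (shift P.1, fiber P.1 P.2) : space) ;
  skewV_continuous : continuous
    (fun P : space => (shiftV P.1, fiberV (shiftV P.1) P.2) : space)
}.

Definition skew (Phi : skew_product) (P : space) : space :=
  (shift P.1, fiber Phi P.1 P.2).
Definition skewV (Phi : skew_product) (P : space) : space :=
  (shiftV P.1, fiberV Phi (shiftV P.1) P.2).

Implicit Types (Phi Psi : skew_product) (Gamma N : set space).

Definition invariant Phi (S : set space) : Prop := skew Phi @` S = S.

Definition maximal_invariant Phi (U : set space) : set space :=
  \bigcup_(S in [set S | S `<=` U /\ invariant Phi S]) S.

Definition asymptotic (f : space -> space) (P Q : space) : Prop :=
  (fun n => pdist (iter n f Q) (iter n f P)) @ \oo --> (0 : R).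

Definition stable_set Phi Gamma : set space :=
  [set P | (fun n => dist_to (iter n (skew Phi) P) Gamma) @ \oo --> 0%E].
Definition unstable_set Phi Gamma : set space :=
  [set P | (fun n => dist_to (iter n (skewV Phi) P) Gamma) @ \oo --> 0%E].

Definition isolating Phi Gamma N : Prop :=
  [/\ compact N, Gamma `<=` N^°
    & forall S, invariant Phi S -> S `<=` N -> S `<=` Gamma].

(* For an isolating neighbourhood N of Gamma, the next three sets are the
   continuation of Gamma and its local stable and unstable sets. *)
Definition continuation Psi N : set space := maximal_invariant Psi N.
Definition stable_set_loc Psi N : set space :=
  [set P | forall n, N (iter n (skew Psi) P)].
Definition unstable_set_loc Psi N : set space :=
  [set P | forall n, N (iter n (skewV Psi) P)].

Definition Ws_eps Phi (eps : R) (P : space) : set space :=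
  [set Q | forall n, pdist (iter n (skew Phi) Q) (iter n (skew Phi) P) <= eps].
Definition Wu_eps Phi (eps : R) (P : space) : set space :=
  [set Q | forall n,
    pdist (iter n (skewV Phi) Q) (iter n (skewV Phi) P) <= eps].

Definition hyperbolic_with Phi Gamma (eps : R) : Prop :=
  [/\ 0 < eps,
      exists K theta : R, [/\ 0 < K, 0 < theta, theta < 1,
        forall P Q n, Gamma P -> Ws_eps Phi eps P Q ->
          pdist (iter n (skew Phi) P) (iter n (skew Phi) Q) <= K * theta ^+ n
      & forall P Q n, Gamma P -> Wu_eps Phi eps P Q ->
          pdist (iter n (skewV Phi) P) (iter n (skewV Phi) Q)
            <= K * theta ^+ n]
    & exists2 delta : R, 0 < delta &
        forall P Q, Gamma P -> Gamma Q -> pdist P Q <= delta ->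
          exists T, Ws_eps Phi eps P `&` Wu_eps Phi eps Q = [set T]].

Definition hyperbolic Phi Gamma : Prop := exists eps, hyperbolic_with Phi Gamma eps.

Definition transitive_set Phi Gamma : Prop :=
  exists2 P, Gamma P &
    Gamma `<=` closure ([set iter n (skew Phi) P | n in [set: nat]] `|`
                        [set iter n (skewV Phi) P | n in [set: nat]]).

Definition ind_cs Phi Gamma (k : nat) : Prop :=
  exists2 eps, hyperbolic_with Phi Gamma eps &
    forall P, Gamma P ->
      covering_dim (Ws_eps Phi eps P `&` ([set P.1] `*` setT)) k.
Definition ind_cu Phi Gamma (k : nat) : Prop :=
  exists2 eps, hyperbolic_with Phi Gamma eps &
    forall P, Gamma P ->
      covering_dim (Wu_eps Phi eps P `&` ([set P.1] `*` setT)) k.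

(* N is the isolating neighbourhood with respect to which the local sets and
   the continuation of Gamma are taken. The last two clauses are the standing
   assumption that the indices are well defined. *)
Definition isolated_transitive_hyperbolic Phi Gamma N : Prop :=
  [/\ compact Gamma /\ invariant Phi Gamma, isolating Phi Gamma N,
      transitive_set Phi Gamma, hyperbolic Phi Gamma
    & (exists k, ind_cs Phi Gamma k) /\ (exists k, ind_cu Phi Gamma k)].

Context (K : nat -> set M) (alpha : R).

(* [K n] is the n.+1-st set of the exhaustion. On the empty set the supremum
   is 0. *)
Definition dC0_on (X : set M) (f g : M -> M) : R :=
  sup [set mdist (f x) (g x) | x in X].
Definition dC0 (f g : M -> M) : R :=
  limn (series (fun n =>
    2 ^- n.+1 * (dC0_on (K n) f g / (1 + dC0_on (K n) f g)))).

Definition lip (f : M -> M) : R :=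
  sup [set r | exists x y, x != y /\ r = mdist (f x) (f y) / mdist x y].

Definition bilipschitz_fibers Phi (g gh : R) : Prop :=
  [/\ 0 < g, 0 < gh & forall xi x y, x != y ->
    g * mdist x y < mdist (fiber Phi xi x) (fiber Phi xi y)
      < gh^-1 * mdist x y].

Definition fibers_holder Phi (C : R) : Prop :=
  0 <= C /\ forall xi zeta : Sigma, xi 0 = zeta 0 ->
    dC0 (fiber Phi xi) (fiber Phi zeta) <= C * mdist xi zeta `^ alpha /\
    dC0 (fiberV Phi xi) (fiberV Phi zeta) <= C * mdist xi zeta `^ alpha.

Definition C0 Phi : R := inf [set C | fibers_holder Phi C].

Definition in_S Phi : Prop :=
  (exists g gh, bilipschitz_fibers Phi g gh) /\ exists C, fibers_holder Phi C.

Definition in_PHS Phi : Prop :=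
  in_S Phi /\
  exists g gh, [/\ bilipschitz_fibers Phi g gh, nu%:num `^ alpha < g, g < 1,
                   1 < gh^-1 & gh^-1 < nu%:num `^ (- alpha)].

Definition dS Phi Psi : R :=
  sup [set Num.max (dC0 (fiber Phi xi) (fiber Psi xi))
                   (dC0 (fiberV Phi xi) (fiberV Psi xi)) | xi in setT]
  + sup [set Num.max `|lip (fiber Phi xi) - lip (fiber Psi xi)|
                     `|lip (fiberV Phi xi) - lip (fiberV Psi xi)| | xi in setT]
  + `|C0 Phi - C0 Psi|.

Definition holder_on (X : set Sigma) (h : Sigma -> M) (C : R) : Prop :=
  0 <= C /\ forall xi zeta, X xi -> X zeta ->
    mdist (h xi) (h zeta) <= C * mdist xi zeta `^ alpha.

Definition holder_const (X : set Sigma) (h : Sigma -> M) : R :=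
  sup [set r | exists xi zeta, [/\ X xi, X zeta, xi != zeta &
                 r = mdist (h xi) (h zeta) / mdist xi zeta `^ alpha]].

Definition dist_holder (X : set Sigma) (h h' : Sigma -> M) : R :=
  sup [set mdist (h xi) (h' xi) | xi in X]
  + `|holder_const X h - holder_const X h'|.

Definition graph_on (X : set Sigma) (h : Sigma -> M) : set space :=
  [set P | X P.1 /\ P.2 = h P.1].

(* With f a skew-product and Wl = Ws_loc these are the local strong stable
   sets, with the inverse map and Wu_loc the local strong unstable sets. A
   Hoelder bound that is uniform over the leaves (for instance
   C0 / (1 - nu ^ alpha / gamma)) makes W unique: if two leaves of such
   partitions share P, then over a common base point their images under the
   n-th iterate are at distance O(nu ^ (alpha n)), while fibre maps contract
   distances by no more than gamma > nu ^ alpha. *)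
Definition strong_partition (f : space -> space) (Wl : Sigma -> set Sigma)
    (W : space -> set space) : Prop :=
  [/\ forall P, W P P,
      forall P Q, W P Q -> W Q = W P,
      exists C : R, forall P, exists2 h,
        holder_on (Wl P.1) h C & W P = graph_on (Wl P.1) h,
      forall P, f @` W P `<=` W (f P)
    & forall P Q, W P Q -> asymptotic f P Q].

(* The point of the leaf W Psi P over a base point depends continuously on
   Psi, on P and on the base point. *)
Definition varies_continuously (D : set skew_product)
    (W : skew_product -> space -> set space) : Prop :=
  forall Psi P Q (eta : R), D Psi -> W Psi P Q -> 0 < eta ->
  exists2 rho : R, 0 < rho &
    forall Psi' P' Q', D Psi' -> dS Psi Psi' < rho -> pdist P P' < rho ->
      W Psi' P' Q' -> mdist Q.1 Q'.1 < rho -> mdist Q.2 Q'.2 < eta.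

(* [Wss Psi P] and [Wuu Psi P] are the local strong stable and unstable sets
   of P for the partially hyperbolic Psi near Phi. *)
Definition strong_laminations Phi
    (Wss Wuu : skew_product -> space -> set space) : Prop :=
  exists2 r : R, 0 < r &
    let D : set skew_product := [set Psi | in_PHS Psi /\ dS Phi Psi < r] in
    [/\ forall Psi, D Psi -> strong_partition (skew Psi) Ws_loc (Wss Psi),
        forall Psi, D Psi -> strong_partition (skewV Psi) Wu_loc (Wuu Psi),
        varies_continuously D Wss & varies_continuously D Wuu].

Definition s_disc (V : set Sigma) (xi : Sigma) (h : Sigma -> M) : Prop :=
  V xi /\ exists C, holder_on (Ws_loc xi `&` V) h C.

Definition s_disc_set (V : set Sigma) (xi : Sigma) (h : Sigma -> M) :
  set space := graph_on (Ws_loc xi `&` V) h.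

(* A collection of s-discs in V x B, each disc being given by its graph. Since
   M has no linear structure, Hoelder functions are close when they are
   uniformly close and their best Hoelder constants are close, as in dS. *)
Definition open_s_discs (V : set Sigma) (B : set M)
    (Ds : set (set space)) : Prop :=
  (forall D, Ds D -> exists xi h,
     [/\ s_disc V xi h, s_disc_set V xi h `<=` V `*` B
       & D = s_disc_set V xi h]) /\
  (forall xi h, s_disc V xi h -> Ds (s_disc_set V xi h) ->
     exists2 eta : R, 0 < eta & forall h', s_disc V xi h' ->
       dist_holder (Ws_loc xi `&` V) h h' < eta ->
       s_disc_set V xi h' `<=` V `*` B /\ Ds (s_disc_set V xi h')).

Definition cs_blender Phi Gamma N (V : set Sigma) (B : set M)
    (Ds : set (set space)) : Prop :=
  [/\ transitive_set Phi Gamma /\ hyperbolic Phi Gamma,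
      exists U, [/\ open U, compact (closure U),
                    Gamma = maximal_invariant Phi U & V `*` B `<=` U],
      exists2 k, ind_cs Phi Gamma k & (0 < k)%N,
      [/\ open V, open B & open_s_discs V B Ds]
    & exists2 delta : R, 0 < delta & forall Psi, in_S Psi ->
        dS Phi Psi < delta ->
        forall D, Ds D -> unstable_set_loc Psi N `&` D !=set0].

(* The leaf W meets V x M, and there it lies in V x B. A leaf over a base
   that misses V is not to be counted: its trace is not an s-disc. *)
Definition crosses (W : set space) (V : set Sigma) (B : set M) : Prop :=
  W `&` (V `*` setT) !=set0 /\ W `&` (V `*` setT) `<=` V `*` B.

Definition Lambda_u Psi (V : set Sigma) (B : set M) : set space :=
  \bigcap_n (iter n (skew Psi) @` (V `*` B)).

(* In the second clause the size rho of the neighbourhood of P does not depend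
   on Psi; in the third one [PP Psi] is the point P_Psi. *)
Definition blender_standing_assumption Phi N (V : set Sigma) (B : set M)
    (Ds : set (set space))
    (Wss Wuu : skew_product -> space -> set space) : Prop :=
  exists2 delta : R, 0 < delta &
  let D : set skew_product := [set Psi | in_PHS Psi /\ dS Phi Psi < delta] in
  [/\ forall Psi P, D Psi -> crosses (Wss Psi P) V B ->
        Ds (Wss Psi P `&` (V `*` setT)),
      forall P, crosses (Wss Phi P) V B ->
        exists2 rho : R, 0 < rho & forall Psi P', D Psi -> pdist P P' < rho ->
          unstable_set_loc Psi N `&` Wss Psi P' !=set0,
      forall P, Lambda_u Phi V B P ->
        exists PP : skew_product -> space,
          (forall Psi, D Psi ->
             Wuu Psi (PP Psi) `&` (V `*` B) `<=` Lambda_u Psi V B) /\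
          (forall eta : R, 0 < eta -> exists2 delta' : R, 0 < delta' &
             forall Psi, D Psi -> dS Phi Psi < delta' ->
               pdist P (PP Psi) < eta)
    & forall Psi, D Psi -> Lambda_u Psi V B `<=` unstable_set_loc Psi N].

(* Every point of the local stable set of Gamma is a limit of points of the
   stable sets of the continuations. This does not follow from [isolating] and
   [hyperbolic]: over a fixed point of the shift let the fibre map of a circle
   have a single fixed point, contracting on its left and expanding on its
   right. The fixed point is an isolated hyperbolic set, and composing the
   fibre map with a small rotation to the right makes its continuation empty. *)
Definition stable_set_continues Phi N : Prop :=
  forall P, stable_set_loc Phi N P -> forall eta : R, 0 < eta ->
  exists2 delta : R, 0 < delta &
    forall Psi, in_PHS Psi -> dS Phi Psi < delta ->
      exists2 Q, stable_set Psi (continuation Psi N) Q & pdist P Q < eta.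

End SkewProducts.

Arguments skew_product {R} A nu M.

(* Main.v *)
Require Import Defs.
From mathcomp Require Import all_boot all_order all_algebra.
From mathcomp Require Import all_classical all_reals all_analysis.
From mathcomp Require Import lra.

Set Implicit Arguments.
Unset Strict Implicit.
Unset Printing Implicit Defensive.

(** The local unstable set of the blender meets every strong stable leaf that is
    close to the leaf of [P_n = Phi^-n(P)], also after perturbation. So it is
    enough to find, for each [Psi] near [Phi], a point of the stable set of the
    continuation of [Gamma2] close to [P_n].

    Such a point exists close to [P] because the stable sets of [Gamma2]
    continue. Its preimage under [Psi^n] still belongs to the stable set, and it
    is close to [P_n] because [Psi^-n(Q)] is jointly continuous at [(Phi, P)]
    ([iter_skewV_near]). The distance of two skew-products controls their fibre
    maps only pointwise, since the exhausting sets need not have interior; what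
    upgrades this to joint continuity is that the inverse fibre maps of all
    partially hyperbolic skew-products have the Lipschitz constant
    [nu ^ (- alpha)] in common ([fiberV_lip]).

    The strong stable leaf of [Psi^-n(Q)] then contains a point [T] of the local
    unstable set of the blender. On the one hand [T] is forward asymptotic to
    [Psi^-n(Q)], hence lies in the stable set of the continuation of [Gamma2].
    On the other hand the backward orbit of [T] stays in the compact set [N1];
    its limit set is invariant, so it is part of the maximal invariant set of
    [N1], and by compactness the orbit converges to it
    ([unstable_set_loc_sub]). *)

Import Order.TTheory GRing.Theory Num.Theory.
Import numFieldNormedType.Exports.
(* Restores [skew] and [shift] as the maps of the dynamics, in place of skew
   forms and translations. *)
Import Defs.

Local Open Scope classical_set_scope.
Local Open Scope ring_scope.

(** * Distances in metric spaces *)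

Section Metric.
Context {R : realType}.

Lemma continuous_mdist (T : topologicalType) (M : metricType R) (f g : T -> M) :
  continuous f -> continuous g -> continuous (fun x => mdist (f x) (g x)).
Proof.
move=> cf cg x; apply/cvgrPdist_lt => e e0.
have e20 : 0 < e / 2 by rewrite divr_gt0.
have /cvg_ballP/(_ _ e20) cfx := cf x.
have /cvg_ballP/(_ _ e20) cgx := cg x.
near=> y.
have fxy : mdist (f x) (f y) < e / 2.
  have : ball (f x) (e / 2) (f y) by near: y.
  by rewrite ballEmdist.
have gxy : mdist (g x) (g y) < e / 2.
  have : ball (g x) (e / 2) (g y) by near: y.
  by rewrite ballEmdist.
have := metric_triangle (f x) (f y) (g x).
have := metric_triangle (f y) (g y) (g x).
have := metric_triangle (f y) (f x) (g y).
have := metric_triangle (f x) (g x) (g y).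
rewrite (metric_sym (f y) (f x)) (metric_sym (g y) (g x)) ltr_norml.
by move=> *; apply/andP; split; lra.
Unshelve. all: by end_near. Qed.

Lemma mdist_compact_bounded (T : topologicalType) (M : metricType R)
    (X : set T) (f g : T -> M) :
  compact (closure X) -> continuous f -> continuous g ->
  has_ubound [set mdist (f x) (g x) | x in X].
Proof.
move=> cX cf cg.
have [C [_ /(_ (C + 1))]] : bounded_set
    ((fun x => mdist (f x) (g x)) @` closure X).
  apply/compact_bounded/continuous_compact => //.
  by apply/continuous_subspaceT/continuous_mdist.
rewrite ltrDl => /(_ ltr01) bC; exists (C + 1) => _ [x Xx <-].
apply: le_trans (ler_norm _) (bC _ _).
by exists x => //; exact: subset_closure.
Qed.

Lemma sup_ge0 (X : set R) : (forall x, X x -> 0 <= x) -> 0 <= sup X.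
Proof.
move=> X0; have [[[x Xx] uX]|nX] := pselect (has_sup X); last by rewrite sup_out.
by apply: le_trans (X0 _ Xx) _; exact: ub_le_sup.
Qed.

End Metric.

(** * The distance of uniform convergence on the exhausting sets *)

Section C0Distance.
Context {R : realType} {M : metricType R} (K : nat -> set M).
Implicit Types f g : M -> M.

Lemma dC0_on_ge0 (X : set M) f g : 0 <= dC0_on X f g.
Proof. by apply: sup_ge0 => _ [x _ <-]; exact: mdist_ge0. Qed.

Let term f g n : R := 2 ^- n.+1 * (dC0_on (K n) f g / (1 + dC0_on (K n) f g)).

Let term_ge0 f g n : 0 <= term f g n.
Proof.
by rewrite mulr_ge0 ?invr_ge0 ?exprn_ge0// divr_ge0 ?addr_ge0 ?dC0_on_ge0.
Qed.

Let term_le f g n : term f g n <= (1 / 2) * (1 / 2) ^+ n.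
Proof.
rewrite -exprS div1r exprVn ler_piMr ?invr_ge0 ?exprn_ge0//.
have d0 := dC0_on_ge0 (K n) f g.
by rewrite ler_pdivrMr ?mul1r ?lerDr// ltr_wpDr.
Qed.

Let half_lt1 : `|1 / 2 : R| < 1.
Proof. by rewrite ger0_norm; lra. Qed.

Let cvg_dC0 f g : cvgn (series (term f g)).
Proof.
apply: (@series_le_cvg _ _ (geometric (1 / 2) (1 / 2))) => // [n|].
- by rewrite mulr_ge0 ?exprn_ge0//; lra.
- exact: is_cvg_geometric_series.
Qed.

Lemma dC0_le1 f g : dC0 K f g <= 1.
Proof.
have -> : 1 = limn (series (geometric (1 / 2 : R) (1 / 2))).
  rewrite (cvg_lim _ (@cvg_geometric_series _ (1 / 2) _ half_lt1))//.
  have -> : 1 - 1 / 2 = 1 / 2 :> R by lra.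
  by rewrite divff// div1r invr_eq0.
exact: (lim_series_le (@cvg_dC0 f g) (is_cvg_geometric_series half_lt1)
  (term_le f g)).
Qed.

Lemma dC0_term_le f g n :
  2 ^- n.+1 * (dC0_on (K n) f g / (1 + dC0_on (K n) f g)) <= dC0 K f g.
Proof.
apply: le_trans (nondecreasing_cvgn_le _ (@cvg_dC0 f g) n.+1).
  rewrite /series/= big_nat_recr//= lerDr; apply: sumr_ge0 => i _.
  exact: term_ge0.
by apply: nondecreasing_series => *; exact: term_ge0.
Qed.

(** The supremum over [K n] is meaningful because the closure is compact: on an
    unbounded set of distances it would be 0 and control nothing. *)
Lemma dC0_dist_small n x (e : R) :
  compact (closure (K n)) -> K n x -> 0 < e ->
  exists2 delta : R, 0 < delta & forall f g,
    continuous f -> continuous g -> dC0 K f g < delta ->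
    mdist (f x) (g x) < e.
Proof.
move=> cK Knx e0.
(* [t / (1 + t)] is increasing, so this is the weight of a distance [e] on [K n]. *)
exists (2 ^- n.+1 * (e / (1 + e))).
  by rewrite mulr_gt0 ?invr_gt0 ?exprn_gt0// divr_gt0// addr_gt0.
move=> f g cf cg /(le_lt_trans (dC0_term_le f g n)).
have d0 := dC0_on_ge0 (K n) f g.
rewrite ltr_pM2l ?invr_gt0 ?exprn_gt0// ltr_pdivrMr ?ltr_wpDr//.
rewrite mulrAC ltr_pdivlMr ?addr_gt0// => de.
apply: (@le_lt_trans _ _ (dC0_on (K n) f g)); last by lra.
by apply: ub_le_sup; [exact: mdist_compact_bounded|exists x].
Qed.

End C0Distance.

(** * Skew-products and their stable and unstable sets *)

Section Skew.
Context {R : realType} {A : finType} {nu : {itv R & `]0%Z, 1%Z[}}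
        {M : metricType R}.
Local Notation Sigma := (shift_space A nu).
Local Notation space := (Sigma * M)%type.
Implicit Types (Phi Psi : skew_product A nu M) (P Q T : space) (N X : set space).

Lemma pdist_ge0 P Q : 0 <= pdist P Q.
Proof. by rewrite le_max mdist_ge0. Qed.

Lemma pdistC P Q : pdist P Q = pdist Q P.
Proof. by rewrite /pdist metric_sym (metric_sym P.2). Qed.

Lemma pdist_triangle Q P T : pdist P T <= pdist P Q + pdist Q T.
Proof.
rewrite ge_max; apply/andP; split.
  by apply: le_trans (metric_triangle _ Q.1 _) (lerD _ _); rewrite le_max lexx.
by apply: le_trans (metric_triangle _ Q.2 _) (lerD _ _);
  rewrite le_max lexx orbT.
Qed.

Lemma ball_pdist P e Q : ball P e Q <-> pdist P Q < e.
Proof.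
rewrite gt_max; split=> [[]|/andP[]]; rewrite ?ballEmdist /=.
  by move=> -> ->.
by move=> h1 h2; split; rewrite ballEmdist.
Qed.

Lemma space_hausdorff : hausdorff_space space.
Proof.
move=> [xi x] [zeta y] xy; congr pair; apply: metric_hausdorff => S B Sx By.
  have [T [ST BT]] := xy _ _ (@cvg_fst _ _ _ _ _ S Sx) (@cvg_fst _ _ _ _ _ B By).
  by exists T.1.
have [T [ST BT]] := xy _ _ (@cvg_snd _ _ _ _ _ S Sx) (@cvg_snd _ _ _ _ _ B By).
by exists T.2.
Qed.

(** This form also covers an empty [X], to which the distance is infinite. *)
Lemma dist_to_cvg0P (u : nat -> space) X :
  ((fun n => dist_to (u n) X) @ \oo --> 0%E) <->
  forall e, 0 < e -> \forall n \near \oo, exists2 L, X L & pdist (u n) L < e.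
Proof.
split=> [cu e e0|cu S].
  have /cu : nbhs (0 : \bar R)%E [set x | (x < e%:E)%E].
    exists e => //= r /=; rewrite sub0r normrN lte_fin => re.
    exact: le_lt_trans (ler_norm _) re.
  apply: (@filterS _ \oo _ [set n | (dist_to (u n) X < e%:E)%E]) => n.
  move=> /ereal_inf_lt[_ [L XL <-]].
  by rewrite lte_fin; exists L.
move=> [e /= e0 eS]; apply: filterS (cu _ e0) => n [L XL uL].
have ge0 : (0 <= dist_to (u n) X)%E.
  by apply: le_ereal_inf_tmp => _ [Q _ <-]; rewrite lee_fin pdist_ge0.
have lte : (dist_to (u n) X < e%:E)%E.
  by apply: le_lt_trans (_ : _ <= (pdist (u n) L)%:E)%E _;
    [apply: ereal_inf_lbound; exists L|rewrite lte_fin].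
move: ge0 lte; rewrite /=; case: (dist_to _ _) => // r r0 re.
by apply: eS; rewrite /= sub0r normrN ger0_norm.
Qed.

Lemma skewK Psi : cancel (skew Psi) (skewV Psi).
Proof.
move=> [xi x]; rewrite /skew /skewV/=.
have -> : shiftV (shift xi) = xi.
  by apply/funext => i; rewrite /shiftV /shift subrK.
by rewrite fiberK.
Qed.

Lemma skewVK Psi : cancel (skewV Psi) (skew Psi).
Proof.
move=> [xi x]; rewrite /skew /skewV/= fiberVK; congr pair.
by apply/funext => i; rewrite /shiftV /shift addrK.
Qed.

Lemma fiberV_continuous Psi xi : continuous (fiberV Psi xi).
Proof.
move=> x.
have -> : fiberV Psi xi = snd \o skewV Psi \o (fun y => (shift xi, y)).
  by apply/funext => y; rewrite /skewV/=; congr fiberV;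
    apply/funext => i; rewrite /shiftV /shift subrK.
apply: continuous_comp.
  exact: (cvg_pair (cvg_cst _) cvg_id).
apply: continuous_comp; [exact: skewV_continuous|exact: cvg_snd].
Qed.

(** The limit set of a backward orbit that stays in [N] is an invariant subset
    of [N], so it is contained in the continuation. An orbit that stayed away
    from the continuation infinitely often would, by compactness, have a limit
    point outside it. *)
Lemma unstable_set_loc_sub Psi N : compact N ->
  unstable_set_loc Psi N `<=` unstable_set Psi (continuation Psi N).
Proof.
move=> cN P NP; apply/dist_to_cvg0P => e e0.
set u := fun n => iter n (skewV Psi) P.
pose omega := cluster (u @ \oo).
have skew_omega L : omega L -> omega (skew Psi L).
  move=> wL S B [m _ mS] /skew_continuous BL.
  have [|Q [SQ BQ]] := wL [set Q | S (skew Psi Q)] _ _ BL.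
    exists m.+1 => // -[//|k] /= mk.
    by rewrite /u/= skewVK; apply: mS.
  by exists (skew Psi Q).
have skewV_omega L : omega L -> omega (skewV Psi L).
  move=> wL S B [m _ mS] /skewV_continuous BL.
  have [|Q [SQ BQ]] := wL [set Q | S (skewV Psi Q)] _ _ BL.
    by exists m => // k /= mk; apply: (mS k.+1); exact: leqW.
  by exists (skewV Psi Q).
have omegaN : omega `<=` N.
  move=> L; rewrite /omega clusterE => /(_ N) wL.
  rewrite (closure_id N).1; last exact: compact_closed space_hausdorff cN.
  by apply: wL; exists 0%N => // k _; exact: NP.
have omega_cont : omega `<=` continuation Psi N.
  move=> L wL; exists omega => //; split=> //.
  apply/seteqP; split => [_ [Q wQ <-]|Q wQ]; first exact: skew_omega.
  by exists (skewV Psi Q); [exact: skewV_omega|exact: skewVK].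
(* Restricting the filter to the far times yields a cluster point of the whole
   orbit that is approached along those times. *)
apply: contrapT => far.
pose far_times : set nat :=
  ~` [set n | exists2 L, continuation Psi N L & pdist (u n) L < e].
have pfar : ProperFilter (within far_times \oo).
  apply: Build_ProperFilter_ex => S inS; apply: contrapT => S0.
  apply: far.
  apply: (@filterS _ \oo _ [set n | far_times n -> S n]) inS => n nS.
  by apply: contrapT => nf; apply: S0; exists n; exact: nS.
have [|L [NL wL]] := cN (u @ within far_times \oo) _.
  by exists 0%N => // k _ _; exact: NP.
have /omega_cont cL : omega L.
  apply: cvg_cluster wL; apply: cvg_app; exact: cvg_within.
have [|_ [[n fn <-] Ln]] :=
    wL [set u n | n in far_times] (ball L e) _ (nbhsx_ballx _ _ e0).
  by exists 0%N => // k _ fk; exists k.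
by apply: fn; exists L => //; rewrite pdistC; apply/ball_pdist.
Qed.

Lemma stable_set_skewV Psi X Q :
  stable_set Psi X Q -> stable_set Psi X (skewV Psi Q).
Proof.
rewrite /stable_set/= => sQ; rewrite -cvg_shiftS/=.
by under eq_fun do rewrite -iterS iterSr skewVK.
Qed.

Lemma stable_set_asymptotic Psi X P Q :
  stable_set Psi X P -> asymptotic (skew Psi) P Q -> stable_set Psi X Q.
Proof.
move=> /dist_to_cvg0P sP aPQ; apply/dist_to_cvg0P => e e0.
have e20 : 0 < e / 2 by rewrite divr_gt0.
have /cvgrPdist_lt/(_ _ e20) aPQe := aPQ.
near=> n.
have [L XL PL] : exists2 L, X L & pdist (iter n (skew Psi) P) L < e / 2.
  by near: n; exact: sP.
exists L => //; apply: le_lt_trans (pdist_triangle (iter n (skew Psi) P) _ _) _.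
rewrite [ltRHS]splitr ltrD//.
have : `|0 - pdist (iter n (skew Psi) Q) (iter n (skew Psi) P)| < e / 2.
  by near: n.
by rewrite sub0r normrN ger0_norm ?pdist_ge0.
Unshelve. all: by end_near. Qed.

End Skew.

(** * Continuity of the inverse in the skew-product *)

Section Perturbation.
Context {R : realType} {A : finType} {nu : {itv R & `]0%Z, 1%Z[}}
        {M : metricType R} (K : nat -> set M) (alpha : R).
Implicit Types (Phi Psi : skew_product A nu M).

(** The bound [dC0 <= 1] makes the first supremum in [dS] a genuine one. The two
    other terms of [dS] are nonnegative even where their suprema degenerate. *)
Lemma dC0_fiberV_le_dS Phi Psi xi :
  dC0 K (fiberV Phi xi) (fiberV Psi xi) <= dS K alpha Phi Psi.
Proof.
rewrite /dS -addrA ler_wpDr//.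
  rewrite addr_ge0 ?normr_ge0//; apply: sup_ge0 => _ [z _ <-].
  by rewrite le_max normr_ge0.
apply: (@le_trans _ _ (Num.max (dC0 K (fiber Phi xi) (fiber Psi xi))
                   (dC0 K (fiberV Phi xi) (fiberV Psi xi)))).
  by rewrite le_max lexx orbT.
apply: ub_le_sup; last by exists xi.
by exists 1 => _ [z _ <-]; rewrite ge_max !dC0_le1.
Qed.

(** Partial hyperbolicity bounds the contraction of the fibre maps below by
    [nu ^ alpha], a rate that is the same for all skew-products. *)
Lemma fiberV_lip Psi xi x y : in_PHS K alpha Psi ->
  mdist (fiberV Psi xi x) (fiberV Psi xi y)
    <= (nu%:num `^ alpha)^-1 * mdist x y.
Proof.
move=> [_ [g [gh [[g0 _ bl] nug _ _ _]]]].
have [->|xy] := eqVneq x y; first by rewrite !mdistxx mulr0.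
have : fiberV Psi xi x != fiberV Psi xi y.
  by apply: contra_neq xy => /(can_inj (fiberVK Psi xi)).
move=> /(bl xi) /andP[+ _]; rewrite !fiberVK => /ltW gxy.
rewrite mulrC ler_pdivlMr ?powR_gt0// mulrC.
by apply: le_trans gxy; rewrite ler_wpM2r ?mdist_ge0// ltW.
Qed.

(** Passing from [skewV Phi P] to [skewV Psi Q], the base points are compared
    by the continuity of [skewV Phi] at [P], the maps by [dC0] at the fixed
    point [P.2], and the fibre points by the common Lipschitz constant. *)
Lemma skewV_near Phi P (rho : R) :
  (forall n, compact (closure (K n))) -> \bigcup_n K n = setT -> 0 < rho ->
  exists2 eta : R, 0 < eta & forall Psi Q, in_PHS K alpha Psi ->
    dS K alpha Phi Psi < eta -> pdist P Q < eta ->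
    pdist (skewV Phi P) (skewV Psi Q) < rho.
Proof.
move=> cK UK rho0; have rho30 : 0 < rho / 3 by rewrite divr_gt0.
have [n _ KnP] : (\bigcup_n K n) P.2 by rewrite UK.
have [d d0 dP] := dC0_dist_small (@cK n) KnP rho30.
have := @skewV_continuous _ _ _ _ Phi P.
move=> /cvg_ballP/(_ _ rho30)/nbhs_ballP[e /= e0 eP].
have c0 : 0 < nu%:num `^ alpha by rewrite powR_gt0.
pose eta := Num.min (Num.min d e) (rho / 3 * nu%:num `^ alpha).
exists eta; first by rewrite !lt_min d0 e0 mulr_gt0.
move=> Psi Q PHS; rewrite !lt_min => /andP[/andP[Psid _] _].
move=> /andP[/andP[_ PQe] PQr].
have /eP /ball_pdist : ball P e (Q.1, P.2).
  apply/ball_pdist; apply: le_lt_trans PQe.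
  by rewrite ge_max/= mdistxx pdist_ge0 le_max lexx.
rewrite -/(skewV _ _) !gt_max/= => /andP[near1 near2].
apply/andP; split; first by lra.
have near3 : mdist (fiberV Phi (shiftV Q.1) P.2)
    (fiberV Psi (shiftV Q.1) P.2) < rho / 3.
  apply: dP; [exact: fiberV_continuous..|].
  exact: le_lt_trans (dC0_fiberV_le_dS _ _ _) Psid.
have near4 : mdist (fiberV Psi (shiftV Q.1) P.2)
    (fiberV Psi (shiftV Q.1) Q.2) < rho / 3.
  apply: le_lt_trans (fiberV_lip _ _ _ PHS) _.
  rewrite mulrC ltr_pdivrMr//; apply: le_lt_trans PQr.
  by rewrite le_max lexx orbT.
apply: le_lt_trans (metric_triangle _ (fiberV Phi (shiftV Q.1) P.2) _) _.
have := metric_triangle (fiberV Phi (shiftV Q.1) P.2)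
  (fiberV Psi (shiftV Q.1) P.2) (fiberV Psi (shiftV Q.1) Q.2).
lra.
Qed.

Lemma iter_skewV_near Phi P n (rho : R) :
  (forall n, compact (closure (K n))) -> \bigcup_n K n = setT -> 0 < rho ->
  exists2 eta : R, 0 < eta & forall Psi Q, in_PHS K alpha Psi ->
    dS K alpha Phi Psi < eta -> pdist P Q < eta ->
    pdist (iter n (skewV Phi) P) (iter n (skewV Psi) Q) < rho.
Proof.
move=> cK UK; elim: n rho => [|n IHn] rho rho0; first by exists rho.
have [e1 e10 step] := skewV_near Phi (iter n (skewV Phi) P) cK UK rho0.
have [e2 e20 prev] := IHn _ e10.
exists (Num.min e1 e2); first by rewrite lt_min e10.
move=> Psi Q PHS; rewrite !lt_min => /andP[d1 d2] /andP[p1 p2].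
by rewrite !iterS; apply: step => //; exact: prev.
Qed.

End Perturbation.

(** * Robust intersection *)

Theorem theorem4p2 (R : realType) (A : finType) (hA : (1 < #|A|)%N)
    (nu : {itv R & `]0%Z, 1%Z[}) (alpha : R) (halpha : 0 < alpha <= 1)
    (M : metricType R) (hM : topological_manifold M)
    (K : nat -> set M) (hK : forall n, compact (closure (K n)))
    (hKM : \bigcup_n K n = setT)
    (Phi : skew_product A nu M) (hPhi : in_PHS K alpha Phi)
    (Wss Wuu : skew_product A nu M ->
       (shift_space A nu * M)%type -> set (shift_space A nu * M)%type)
    (hW : strong_laminations K alpha Phi Wss Wuu)
    (Gamma1 N1 Gamma2 N2 : set (shift_space A nu * M)%type)
    (hGamma1 : isolated_transitive_hyperbolic Phi Gamma1 N1)
    (hGamma2 : isolated_transitive_hyperbolic Phi Gamma2 N2)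
    (hcont : stable_set_continues K alpha Phi N2)
    (V : set (shift_space A nu)) (B : set M)
    (Ds : set (set (shift_space A nu * M)%type))
    (hblender : cs_blender K alpha Phi Gamma1 N1 V B Ds)
    (hstanding : blender_standing_assumption K alpha Phi N1 V B Ds Wss Wuu)
    (P : (shift_space A nu * M)%type) (hP : stable_set_loc Phi N2 P)
    (n : nat) (hn : crosses (Wss Phi (iter n (skewV Phi) P)) V B) :
  exists2 delta : R, 0 < delta &
    forall Psi : skew_product A nu M,
      in_PHS K alpha Psi -> dS K alpha Phi Psi < delta ->
      unstable_set Psi (continuation Psi N1) `&`
        stable_set Psi (continuation Psi N2) !=set0.
Proof.
have [r r0 [Wss_part _ _ _]] := hW.
have [d d0 [_ blend _ _]] := hstanding.
have [_ [cN1 _ _] _ _ _] := hGamma1.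
have [rho rho0 meets] := blend _ hn.
have [eta eta0 near_n] := iter_skewV_near alpha Phi P n hK hKM rho0.
have [e e0 cont] := hcont _ hP _ eta0.
exists (Num.min (Num.min r d) (Num.min eta e)).
  by rewrite !lt_min r0 d0 eta0.
move=> Psi PHS; rewrite !lt_min => /andP[/andP[dr dd] /andP[deta de]].
have [Q sQ PQ] := cont Psi PHS de.
have [T [uT WT]] := meets Psi _ (conj PHS dd) (near_n _ _ PHS deta PQ).
exists T; split; first exact: unstable_set_loc_sub.
have [_ _ _ _ asym] := Wss_part Psi (conj PHS dr).
apply: stable_set_asymptotic (asym _ _ WT).
by elim: (n) => [//|k IHk]; exact: stable_set_skewV.
Qed.
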